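(* Every Hausdorff monothetic non-viscous topological monoid $S$ is cancellative.
   Context: A topological monoid is a semigroup with identity $1$ endowed with a topology such that the multiplication is jointly continuous. $S$ is monothetic if there is $a\in S$ with $S=\overline{\{a^n:n\ge 1\}}$. $S$ is non-viscous if for any neighborhood $U$ of the identity $1$ of $S$ and any element $a\in S$ there exists a neighborhood $V$ of $a$ such that any element $x\in S$ with $(xV\cup Vx)\cap V\ne\emptyset$ belongs to $U$. $S$ is cancellative if for any $a,x,y\in S$, the equality $ax=ay$ or $xa=ya$ implies $x=y$. *)

(* Defs.v *)
From HB Require Import structures.
From mathcomp Require Import all_boot all_order.
From mathcomp Require Import all_classical topology.

Set Implicit Arguments.
Unset Strict Implicit.
Unset Printing Implicit Defensive.

Local Open Scope classical_set_scope.
Local Open Scope group_scope.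

HB.structure Definition PreTopologicalMonoid :=
  {S of Topological S & monoid.Monoid S}.

HB.mixin Record PreTopologicalMonoid_isTopologicalMonoid S
    & PreTopologicalMonoid S := {
  mulg_continuous : continuous (fun xy : S * S => xy.1 * xy.2)
}.

#[short(type="topologicalMonoidType")]
HB.structure Definition TopologicalMonoid :=
  {S of PreTopologicalMonoid S & PreTopologicalMonoid_isTopologicalMonoid S}.

Definition monothetic (S : topologicalMonoidType) : Prop :=
  exists a : S, closure [set a ^+ n | n in [set n | (1 <= n)%N]] = [set: S].

(* [nbhs] contains all neighborhoods, open or not; the notion is the same if U
   and V are restricted to open neighborhoods. *)
Definition non_viscous (S : topologicalMonoidType) : Prop :=
  forall (U : set S) (a : S), nbhs (1 : S) U ->
    exists2 V : set S, nbhs a V &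
      forall x : S,
        ([set x * v | v in V] `|` [set v * x | v in V]) `&` V !=set0 -> U x.

Definition cancellative (S : semigroupType) : Prop :=
  forall a x y : S, a * x = a * y \/ x * a = y * a -> x = y.

(* Main.v *)
(** Suppose [c x = c y]; approximate [x] by [g ^ n] and [y] by [g ^ m], with
    [n <= m] say.  Then [c g ^ n] and [c g ^ m = (c g ^ n) g ^ (m - n)] are both
    close to the same point [c x = c y], so non-viscosity puts [g ^ (m - n)]
    near [1].  Hence [g ^ m = g ^ n g ^ (m - n)], which is close to [y], is also
    close to [x], and [x = y] by separation. *)
Require Import Defs.
From mathcomp Require Import all_boot all_order.
From mathcomp Require Import all_classical topology.

Set Implicit Arguments.
Unset Strict Implicit.
Unset Printing Implicit Defensive.

Local Open Scope classical_set_scope.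
Local Open Scope group_scope.

Lemma continuous_mulg_left (S : topologicalMonoidType) (c : S) :
  continuous (fun x => c * x).
Proof.
move=> x; apply: (cvg_comp (fun y => (c, y)) _ _ (@mulg_continuous S (c, x))).
exact: (cvg_pair (cvg_cst c) cvg_id).
Qed.

Lemma continuous_mulg_right (S : topologicalMonoidType) (c : S) :
  continuous (fun x => x * c).
Proof.
move=> x; apply: (cvg_comp (fun y => (y, c)) _ _ (@mulg_continuous S (x, c))).
exact: (cvg_pair cvg_id (cvg_cst c)).
Qed.

Lemma nbhs_mulg1 (S : topologicalMonoidType) (x : S) (A : set S) :
  nbhs x A -> exists2 W, nbhs x W &
  exists2 U, nbhs (1 : S) U & forall w u, W w -> U u -> A (w * u).
Proof.
move=> xA; have : nbhs (x * 1) A by rewrite mulg1.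
case/(@mulg_continuous S (x, 1)) => -[W U] /= [xW oneU] WU.
by exists W => //; exists U => // w u Ww Uu; exact: (WU (w, u)).
Qed.

(** An abstract [f] treats left and right translations at once: raising the exponent by [k]
    multiplies the value by [g ^+ k] on one side, and non-viscosity accepts either side. *)
Lemma dense_powers_inj (S : topologicalMonoidType) (g : S) (f : S -> S) :
    hausdorff_space S -> non_viscous S ->
    closure [set g ^+ n | n in [set n | (1 <= n)%N]] = [set: S] ->
    continuous f ->
    (forall n k, f (g ^+ (n + k)) = f (g ^+ n) * g ^+ k \/
                 f (g ^+ (n + k)) = g ^+ k * f (g ^+ n)) ->
  injective f.
Proof.
move=> hS nvS dense_g cf fD x y fxy; apply: hS => A B xA yB.
have [WA xWA [UA UA1 WUA]] := nbhs_mulg1 xA.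
have [WB yWB [UB UB1 WUB]] := nbhs_mulg1 yB.
(* Either exponent may turn out larger, so the quotient power must suit both [x] and [y]. *)
have [V fxV VU] := nvS (UA `&` UB) (f x) (filterI UA1 UB1).
have close n k : V (f (g ^+ n)) -> V (f (g ^+ (n + k))) ->
    (UA `&` UB) (g ^+ k).
  move=> Vn Vnk; apply: VU; exists (f (g ^+ (n + k))); split=> //.
  by case: (fD n k) => ->; [right | left]; exists (f (g ^+ n)).
have approx (z : S) W : nbhs z W -> exists n, W (g ^+ n).
  move=> zW; have : closure [set g ^+ n | n in [set n | (1 <= n)%N]] z.
    by rewrite dense_g.
  by move=> /(_ _ zW) [_ [[n _ <-] Wn]]; exists n.
have fyV : nbhs (f y) V by rewrite -fxy.
have [n [[An WAn] Vn]] := approx _ _ (filterI (filterI xA xWA) (cf x V fxV)).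
have [m [[Bm WBm] Vm]] := approx _ _ (filterI (filterI yB yWB) (cf y V fyV)).
case/orP: (leq_total n m) => le_nm.
(* The larger power is in [B] by choice, and in [A] as [g ^+ n] in [WA] times [g ^+ (m - n)] in
   [UA]. *)
- exists (g ^+ m); split=> //.
  rewrite -(subnKC le_nm) expgnDr; apply: WUA => //.
  by apply: (close n _ _ _).1 => //; rewrite subnKC.
- exists (g ^+ n); split=> //.
  rewrite -(subnKC le_nm) expgnDr; apply: WUB => //.
  by apply: (close m _ _ _).2 => //; rewrite subnKC.
Qed.

Theorem proposition3p5 (S : topologicalMonoidType) :
  hausdorff_space S -> monothetic S -> non_viscous S -> cancellative S.
Proof.
move=> hS [g dense_g] nvS c x y [].
- apply: (dense_powers_inj hS nvS dense_g (@continuous_mulg_left S c)) => n k.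
  by left; rewrite expgnDr mulgA.
- apply: (dense_powers_inj hS nvS dense_g (@continuous_mulg_right S c)) => n k.
  (* With [c] on the right, [g ^+ k] must split off on the left, hence the swapped exponents. *)
  by right; rewrite addnC expgnDr mulgA.
Qed.
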